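(* Let $\nu_i:\mathcal O(X)\to\mathcal B(\mathcal H_i)$, $i=1,2$, be cleanly equivalent quantum probability measures. If $\nu_1$ is non-atomic, then $\nu_2$ is non-atomic.
   Context: $X$ is a locally compact Hausdorff space with Borel $\sigma$-algebra $\mathcal O(X)$; $\mathcal H_1,\mathcal H_2$ are Hilbert spaces. A quantum probability measure $\nu:\mathcal O(X)\to\mathcal B(\mathcal H)$ is a map with positive operator values that is countably additive on pairwise disjoint countable families, with convergence in the ultraweak topology, and satisfies $\nu(X)=I_{\mathcal H}$. An atom of $\nu$ is a set $A\in\mathcal O(X)$ with $\nu(A)\neq 0$ such that every measurable $B\subseteq A$ satisfies $\nu(B)=0$ or $\nu(B)=\nu(A)$; $\nu$ is non-atomic if it has no atoms. A quantum channel $\Phi:\mathcal T(\mathcal H)\to\mathcal T(\mathcal K)$ is a completely positive, trace preserving linear map between the spaces of trace class operators; its dual $\Phi^*:\mathcal B(\mathcal K)\to\mathcal B(\mathcal H)$ is completely positive, unital and linear. $\nu_1$ is cleaner than $\nu_2$, written $\nu_2\ll_{\rm cl}\nu_1$, if $\nu_2=\Phi^*\circ\nu_1$ for some quantum channel $\Phi:\mathcal T(\mathcal H_2)\to\mathcal T(\mathcal H_1)$. $\nu_1$ and $\nu_2$ are cleanly equivalent if $\nu_1\ll_{\rm cl}\nu_2$ and $\nu_2\ll_{\rm cl}\nu_1$. *)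

(* Defs.v *)
From HB Require Import structures.
From mathcomp Require Import all_boot all_order all_algebra.
From mathcomp Require Import all_classical all_reals all_analysis.
From mathcomp Require Import complex showcase.summability.

Set Implicit Arguments.
Unset Strict Implicit.
Unset Printing Implicit Defensive.

Import numFieldNormedType.Exports.
Import Order.TTheory GRing.Theory Num.Theory.

Local Open Scope classical_set_scope.
Local Open Scope ring_scope.

(* The library only declares the norm topology on R[i]^o. *)
HB.instance Definition _ (R : realType) := NormedModule.copy R[i] R[i]^o.

(* The inner product is linear in its first argument. *)
HB.mixin Record isHilbert (R : realType) H & CompleteNormedModule R[i] H := {
  inner : {dot H for @Num.conj R[i]};
  inner_norm : forall x, inner x x = `|x| ^+ 2
}.

#[short(type="hilbertType")]
HB.structure Definition Hilbert (R : realType) :=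
  {H of CompleteNormedModule R[i] H & isHilbert R H}.

Section BoundedOperators.
Context {R : realType} (H : hilbertType R).

Definition bounded_op : {pred H -> H} := fun T =>
  `[< linear T /\ exists M : R[i], forall x, `|T x| <= M * `|x| >].

Fact bounded_op_submod_closed : submod_closed bounded_op.
Proof.
split=> [|a S T /asboolP[lS [M bS]] /asboolP[lT [N bT]]]; apply/asboolP.
  split=> [b x y|]; first by rewrite /= scaler0 addr0.
  by exists 0 => x; rewrite normr0 mul0r.
split=> [b x y|].
  rewrite !fctE lS lT !scalerDr !scalerA mulrC -!addrA.
  by congr (_ + _); rewrite addrCA.
exists (`|a| * M + N) => x; rewrite !fctE mulrDl -mulrA.
apply: le_trans (ler_normD _ _) (lerD _ (bT x)).
by rewrite normrZ ler_wpM2l.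
Qed.

HB.instance Definition _ :=
  GRing.isSubmodClosed.Build R[i] (H -> H) bounded_op bounded_op_submod_closed.

Record Bop := MkBop { op :> H -> H; _ : op \in bounded_op }.

HB.instance Definition _ := [isSub for op].
HB.instance Definition _ := [Choice of Bop by <:].
HB.instance Definition _ := [SubChoice_isSubLmodule of Bop by <:].

End BoundedOperators.

Section TraceClass.
Context {R : realType} {H : hilbertType R}.

Definition positive_op (T : H -> H) : Prop := forall x, 0 <= inner (T x) x.

Definition orthonormal_set (B : set H) : Prop :=
  forall e f, B e -> B f -> inner e f = (e == f)%:R.

Definition orthonormal_basis (B : set H) : Prop :=
  orthonormal_set B /\
  forall B', orthonormal_set B' -> B `<=` B' -> B' = B.

(* Unordered sums: H is not assumed to be separable. *)
Definition has_trace (T : H -> H) (t : R[i]) : Prop :=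
  forall B : set H, orthonormal_basis B ->
    partial_sum (fun e : B => inner (T (val e)) (val e)) @ totally --> t.

Definition trace (T : H -> H) : R[i] := xget 0 (has_trace T).

(* S = |T|, i.e. S is the positive operator with S^2 = T^* T. *)
Definition is_abs_op (T S : Bop H) : Prop :=
  positive_op S /\ forall x y, inner (S (S x)) y = inner (T x) (T y).

Definition trace_class (T : Bop H) : Prop :=
  exists2 S : Bop H, is_abs_op T S & exists t, has_trace S t.

(* Convergence of a sequence in the ultraweak (weak-star) topology of B(H),
   the predual of B(H) being the space of trace class operators. *)
Definition ultraweak_cvg (u : nat -> Bop H) (l : Bop H) : Prop :=
  forall S : Bop H, trace_class S ->
    trace (op S \o op (u n)) @[n --> \oo] --> trace (op S \o op l).

End TraceClass.

Record TraceOp {R : realType} (H : hilbertType R) :=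
  MkTraceOp { trace_op :> Bop H; trace_opP : trace_class trace_op }.

Section Channels.
Context {R : realType} {H K : hilbertType R}.

(* Every linear combination of trace class operators is trace class, so U
   ranges over all linear combinations. *)
Definition linear_on_trace_class (Phi : TraceOp H -> TraceOp K) : Prop :=
  forall (a : R[i]) (S T U : TraceOp H),
    trace_op U = a *: trace_op S + trace_op T ->
    trace_op (Phi U) = a *: trace_op (Phi S) + trace_op (Phi T).

Definition trace_preserving (Phi : TraceOp H -> TraceOp K) : Prop :=
  forall S, trace (Phi S) = trace S.

End Channels.

(* Positivity on the direct sum of n copies of H of the operator with blocks
   A i j. *)
Definition positive_block {R : realType} {H : hilbertType R} (n : nat)
    (A : 'I_n -> 'I_n -> H -> H) : Prop :=
  forall x : 'I_n -> H, 0 <= \sum_i \sum_j inner (A i j (x j)) (x i).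

Definition completely_positive {R : realType} {H K : hilbertType R}
    (Phi : TraceOp H -> TraceOp K) : Prop :=
  forall n (S : 'I_n -> 'I_n -> TraceOp H),
    positive_block (fun i j => S i j) ->
    positive_block (fun i j => Phi (S i j)).

Definition quantum_channel {R : realType} {H K : hilbertType R}
    (Phi : TraceOp H -> TraceOp K) : Prop :=
  [/\ linear_on_trace_class Phi, completely_positive Phi
    & trace_preserving Phi].

(* Phid is the dual Phi^* of Phi for the pairing (S, A) |-> tr (S A). *)
Definition is_dual {R : realType} {H K : hilbertType R}
    (Phi : TraceOp H -> TraceOp K) (Phid : {linear Bop K -> Bop H}) : Prop :=
  forall (S : TraceOp H) (A : Bop K),
    trace (op S \o op (Phid A)) = trace (op (Phi S) \o op A).

Section QuantumMeasures.
Context {R : realType} {X : topologicalType}.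

Definition borel : set_system X := <<s @open X>>.

(* As for measures in the library, nu is a total function on subsets of X;
   only its values on Borel sets are meaningful. *)
Definition quantum_probability {H : hilbertType R} (nu : set X -> Bop H) : Prop :=
  [/\ forall E, borel E -> positive_op (nu E),
      forall F : nat -> set X, (forall k, borel (F k)) -> trivIset setT F ->
        ultraweak_cvg (fun n => \sum_(k < n) nu (F k)) (nu (\bigcup_k F k))
    & op (nu setT) = id].

Definition atom {H : hilbertType R} (nu : set X -> Bop H) (A : set X) : Prop :=
  [/\ borel A, nu A <> 0
    & forall B, borel B -> B `<=` A -> nu B = 0 \/ nu B = nu A].

Definition non_atomic {H : hilbertType R} (nu : set X -> Bop H) : Prop :=
  forall A, ~ atom nu A.

(* cleaner nu1 nu2 is nu2 <<_cl nu1. *)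
Definition cleaner {H1 H2 : hilbertType R}
    (nu1 : set X -> Bop H1) (nu2 : set X -> Bop H2) : Prop :=
  exists (Phi : TraceOp H2 -> TraceOp H1) (Phid : {linear Bop H1 -> Bop H2}),
    [/\ quantum_channel Phi, is_dual Phi Phid
      & forall E, borel E -> nu2 E = Phid (nu1 E)].

Definition cleanly_equivalent {H1 H2 : hilbertType R}
    (nu1 : set X -> Bop H1) (nu2 : set X -> Bop H2) : Prop :=
  cleaner nu2 nu1 /\ cleaner nu1 nu2.

End QuantumMeasures.

(* Main.v *)
Require Import Defs.
From HB Require Import structures.
From mathcomp Require Import all_boot all_order all_algebra.
From mathcomp Require Import all_classical all_reals all_analysis.

Set Implicit Arguments.
Unset Strict Implicit.
Unset Printing Implicit Defensive.

Local Open Scope classical_set_scope.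

(** A dual channel is a linear map, hence preserves equality and sends 0 to 0.
    If the values of [nu1] are the images of those of [nu2] under such a map,
    the dichotomy that defines an atom [A] of [nu2] is therefore inherited by
    [nu1]; only [nu1 A <> 0] could fail.  The dual channel in the other
    direction excludes this: it sends [nu1 A] to [nu2 A], which is nonzero.
    So measures that are cleaner than each other have the same atoms. *)

(** This is the contrapositive of preservation of 0 by the dual channel. *)
Lemma cleaner_neq0 (R : realType) (X : topologicalType) (H1 H2 : hilbertType R)
    (nu1 : set X -> Bop H1) (nu2 : set X -> Bop H2) (A : set X) :
  cleaner nu1 nu2 -> borel A -> nu2 A <> 0%R -> nu1 A <> 0%R.
Proof.
move=> [_ [Phid [_ _ nu2E]]] bA nu2A0 nu1A0; apply: nu2A0.
by rewrite nu2E // nu1A0 GRing.raddf0.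
Qed.

Lemma cleaner_atom (R : realType) (X : topologicalType) (H1 H2 : hilbertType R)
    (nu1 : set X -> Bop H1) (nu2 : set X -> Bop H2) (A : set X) :
  cleaner nu1 nu2 -> nu2 A <> 0%R -> atom nu1 A -> atom nu2 A.
Proof.
move=> [_ [Phid [_ _ nu2E]]] nu2A0 [bA _ dichA]; split=> // B bB subBA.
rewrite !nu2E //.
by have [->|->] := dichA B bB subBA; [left; rewrite GRing.raddf0|right].
Qed.

Theorem proposition4p9 (R : realType) (X : topologicalType)
    (lcX : locally_compact [set: X]) (hausX : hausdorff_space X)
    (H1 H2 : hilbertType R)
    (nu1 : set X -> Bop H1) (nu2 : set X -> Bop H2)
    (qp1 : quantum_probability nu1) (qp2 : quantum_probability nu2)
    (eq12 : cleanly_equivalent nu1 nu2) :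
  non_atomic nu1 -> non_atomic nu2.
Proof.
have [nu21 nu12] := eq12.
move=> na1 A atomA; apply: (na1 A); have [bA nu2A0 _] := atomA.
exact: cleaner_atom nu21 (cleaner_neq0 nu12 bA nu2A0) atomA.
Qed.
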